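(* Let $f$ be a smooth real function and let $R_1(u,v)=(u\cosh v,\,u\sinh v,\,f(u))$ be the rotational surface with space-like meridians in the pseudo-isotropic space $\mathbb{I}_p^3$. The time-like loxodromes on $R_1$ (with constant pseudo-isotropic angle $\eta$ to the meridians) are $$\gamma_2(t)=\bigl(\pm t\sinh\eta\,\cosh(\pm\coth\eta\,\ln|t|),\ \pm t\sinh\eta\,\sinh(\pm\coth\eta\,\ln|t|),\ f(\pm t\sinh\eta)\bigr),$$ where $\eta\in\mathbb{R}^+\cup\{0\}$.
   Context: Pseudo-isotropic space $\mathbb{I}_p^3$ is $\mathbb{R}^3$ with coordinates $(x,y,z)$ and the pseudo-isotropic scalar product, for $p=(p_1,p_2,p_3)$ and $q=(q_1,q_2,q_3)$: $\langle p,q\rangle=p_3q_3$ if $p_1=p_2=0$ and $q_1=q_2=0$, and $\langle p,q\rangle=p_1q_1-p_2q_2$ otherwise. A vector $(0,0,p_3)$ is called isotropic; other vectors are non-isotropic. A non-isotropic vector $p$ is space-like if $\langle p,p\rangle>0$ (the zero vector is also counted as space-like), time-like if $\langle p,p\rangle<0$, light-like if $\langle p,p\rangle=0$ and $p\neq0$; a curve is space-like (time-like) if its velocity vectors are. Put $\|p\|=\sqrt{|\langle p,p\rangle|}$. The surface $R_1$ is obtained by applying the hyperbolic rotations $(x,y,z)\mapsto(x\cosh v+y\sinh v,\ x\sinh v+y\cosh v,\ z)$, $v\in\mathbb{R}$, to the space-like profile curve $\alpha_1(u)=(u,0,f(u))$. Its induced metric is $ds^2=du^2-u^2dv^2$.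 Its meridians are the curves $\beta_v(u)=R_1(u,v)$ with $v$ constant; they are space-like. The pseudo-isotropic angle $\eta\in\mathbb{R}^+\cup\{0\}$ between a space-like non-isotropic vector $p$ and a time-like non-isotropic vector $q$ is given by $|\langle p,q\rangle|=\|p\|\,\|q\|\sinh\eta$. A loxodrome is a curve on the rotational surface which cuts all meridians at a constant angle, i.e. the angle between its velocity vector at each of its points and the meridian's tangent vector $\beta_v'$ at that point is constant. In the formula, the curve is $\gamma_2(t)=R_1(u(t),v(t))$ with $u(t)=\pm t\sinh\eta$ and $v(t)=\pm\coth\eta\,\ln|t|$, the sign of $u$ being the same in all three components and the sign of $v$ the same in both components where it occurs.
   Formalization: The formula is asserted for η > 0 only; for η = 0, where coth η is undefined, the loxodromes are shown to be the parallels u = r ≠ 0. Conversely, each loxodrome equals γ₂ in an arc-length parameter, up to a hyperbolic rotation (constant added to v), which the stated formula omits. *)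

(* Defs.v *)
From Stdlib Require Import Reals.
From Coquelicot Require Import Coquelicot.
Open Scope R_scope.

(** Pseudo-isotropic space: R^3 with a degenerate scalar product. *)

Definition vec3 : Type := (R * R * R)%type.

Definition px (p : vec3) : R := fst (fst p).
Definition py (p : vec3) : R := snd (fst p).
Definition pz (p : vec3) : R := snd p.

(** With this definition the zero vector is isotropic. *)
Definition isotropic (p : vec3) : Prop := px p = 0 /\ py p = 0.

Definition isotropic_dec (p : vec3) : {isotropic p} + {~ isotropic p}.
Proof.
  unfold isotropic.
  destruct (Req_EM_T (px p) 0) as [hx | hx].
  - destruct (Req_EM_T (py p) 0) as [hy | hy].
    + left; split; assumption.
    + right; intros [_ h]; exact (hy h).
  - right; intros [h _]; exact (hx h).
Defined.

Definition scal_pi (p q : vec3) : R :=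
  match isotropic_dec p, isotropic_dec q with
  | left _, left _ => pz p * pz q
  | _, _ => px p * px q - py p * py q
  end.

Definition norm_pi (p : vec3) : R := sqrt (Rabs (scal_pi p p)).

Definition spacelike (p : vec3) : Prop :=
  p = (0, 0, 0) \/ (~ isotropic p /\ 0 < scal_pi p p).

Definition timelike (p : vec3) : Prop :=
  ~ isotropic p /\ scal_pi p p < 0.

(** [eta] is the pseudo-isotropic angle between the space-like non-isotropic
    vector [p] and the time-like non-isotropic vector [q]. *)
Definition is_angle_pi (p q : vec3) (eta : R) : Prop :=
  spacelike p /\ ~ isotropic p /\ timelike q /\ 0 <= eta /\
  Rabs (scal_pi p q) = norm_pi p * norm_pi q * sinh eta.

(** Open intervals [(a, b)] with possibly infinite end points. *)
Definition in_itv (a b : Rbar) (t : R) : Prop := Rbar_lt a t /\ Rbar_lt t b.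

Definition smooth_on (a b : Rbar) (g : R -> R) : Prop :=
  forall (n : nat) (t : R), in_itv a b t -> ex_derive_n g n t.

Definition velocity (c : R -> vec3) (t : R) : vec3 :=
  (Derive (fun s => px (c s)) t,
   Derive (fun s => py (c s)) t,
   Derive (fun s => pz (c s)) t).

Definition hrot (w : R) (p : vec3) : vec3 :=
  (px p * cosh w + py p * sinh w, px p * sinh w + py p * cosh w, pz p).

(** [R1 f u v] is [hrot v] applied to the point [(u, 0, f u)] of the profile
    curve. *)
Definition R1 (f : R -> R) (u v : R) : vec3 := (u * cosh v, u * sinh v, f u).

Definition meridian (f : R -> R) (v : R) : R -> vec3 := fun u => R1 f u v.

(** A smooth curve on the surface is given by smooth coordinates [u], [v];
    the meridian through its point at parameter [t] is the one of index [v t],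
    taken at parameter [u t]. *)
Definition timelike_loxodrome
    (f : R -> R) (eta : R) (a b : Rbar) (c : R -> vec3) : Prop :=
  exists u v : R -> R,
    smooth_on a b u /\ smooth_on a b v /\
    forall t : R, in_itv a b t ->
      c t = R1 f (u t) (v t) /\
      timelike (velocity c t) /\
      is_angle_pi (velocity (meridian f (v t)) (u t)) (velocity c t) eta.

Definition coth (x : R) : R := cosh x / sinh x.

Definition is_sign (e : R) : Prop := e = 1 \/ e = -1.

(** [e1] and [e2] are the signs of [u] and [v].  The formula is meaningful for
    [sinh eta <> 0] and [t <> 0] only. *)
Definition gamma2 (f : R -> R) (e1 e2 eta : R) (t : R) : vec3 :=
  (e1 * t * sinh eta * cosh (e2 * coth eta * ln (Rabs t)),
   e1 * t * sinh eta * sinh (e2 * coth eta * ln (Rabs t)),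
   f (e1 * t * sinh eta)).

(** For [eta = 0], where [coth] has a pole, [gamma2] is replaced by the
    parallel [u = r] at unit speed.  It is the limit as [eta] tends to 0 of
    [gamma2], once the parameter is shifted so that [u = r] at [t = 0] and the
    curve is rotated so that [v = 0] there. *)
Definition parallel_curve (f : R -> R) (e r : R) (t : R) : vec3 :=
  R1 f r (e * t / r).

(** [phi] is a smooth arc-length parameter of the curve [c] on [(a, b)]. *)
Definition arc_length_parameter (a b : Rbar) (c : R -> vec3) (phi : R -> R)
  : Prop :=
  smooth_on a b phi /\
  forall s : R, in_itv a b s -> is_derive phi s (norm_pi (velocity c s)).

(* Main.v *)
(** For the curve [R1 f (u t) (v t)] put [L^2 = (u v')^2 - u'^2].  The curve is
    time-like iff [L^2 > 0], its speed is then [L], and it makes the angle [eta]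
    with the meridians iff [|u'| = L sinh eta].  If [eta > 0], then [u'] and
    [u v'] never vanish, so they have constant signs; hence
    [phi = +- u / sinh eta] is an arc-length parameter, and
    [(u v')^2 = L^2 cosh^2 eta] gives [v' = +- coth eta u' / u], that is,
    [v = +- coth eta ln |phi| + w].  If [eta = 0], then [u] is a nonzero
    constant [r] and [phi = +- r v] is an arc-length parameter. *)

Require Import Defs.
From Stdlib Require Import Reals Lra Ranalysis5 Factorial.
From Coquelicot Require Import Coquelicot.
Open Scope R_scope.

(** * Hyperbolic functions, rotations and signs *)

Lemma cosh_gt_0 (x : R) : 0 < cosh x.
Proof. unfold cosh; pose proof (exp_pos x); pose proof (exp_pos (- x)); lra. Qed.

Lemma cosh_sqr (x : R) : cosh x * cosh x = 1 + sinh x * sinh x.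
Proof.
  assert (h : exp x * exp (- x) = 1).
  { rewrite <- exp_plus, Rplus_opp_r; exact exp_0. }
  unfold cosh, sinh; lra.
Qed.

Lemma cosh_plus (x y : R) : cosh (x + y) = cosh x * cosh y + sinh x * sinh y.
Proof. unfold cosh, sinh; rewrite Ropp_plus_distr, !exp_plus; field. Qed.

Lemma sinh_plus (x y : R) : sinh (x + y) = sinh x * cosh y + cosh x * sinh y.
Proof. unfold cosh, sinh; rewrite Ropp_plus_distr, !exp_plus; field. Qed.

Lemma sinh_gt_0 (x : R) : 0 < x -> 0 < sinh x.
Proof. intros hx; rewrite <- sinh_0; apply sinh_lt; exact hx. Qed.

(** By the addition formulas, rotating the surface shifts [v]. This is what later absorbs the
    integration constant of [v]. *)
Lemma hrot_R1 (f : R -> R) (u v w : R) : hrot w (Defs.R1 f u v) = Defs.R1 f u (v + w).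
Proof.
  unfold hrot, Defs.R1, px, py, pz; cbn [fst snd].
  rewrite cosh_plus, sinh_plus; do 2 f_equal; ring.
Qed.

Lemma is_sign_sqr (e : R) : is_sign e -> e * e = 1.
Proof. intros [-> | ->]; ring. Qed.

Lemma is_sign_Rabs (e : R) : is_sign e -> Rabs e = 1.
Proof. intros [-> | ->]; [apply Rabs_R1 | rewrite Rabs_left; lra]. Qed.

(** * Open intervals: constant sign and constancy *)

Lemma in_itv_locally (a b : Rbar) (t : R) : in_itv a b t -> locally t (in_itv a b).
Proof.
  intros [ha hb].
  apply filter_and; [exact (open_Rbar_gt a t ha) | exact (open_Rbar_lt b t hb)].
Qed.

Lemma in_itv_between (a b : Rbar) (s t x : R) :
  in_itv a b s -> in_itv a b t -> Rmin s t <= x <= Rmax s t -> in_itv a b x.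
Proof.
  intros [has hsb] [hat htb] [h1 h2]; split.
  - apply Rbar_lt_le_trans with (Rmin s t); [| exact h1].
    unfold Rmin; destruct (Rle_dec s t); assumption.
  - apply Rbar_le_lt_trans with (Rmax s t); [exact h2 |].
    unfold Rmax; destruct (Rle_dec s t); assumption.
Qed.

Lemma in_itv_inhabited (a b : Rbar) : Rbar_lt a b -> exists t : R, in_itv a b t.
Proof.
  unfold in_itv; destruct a as [a | |], b as [b | |]; simpl; intros h;
    try contradiction.
  - exists ((a + b) / 2); lra.
  - exists (a + 1); split; [lra | exact I].
  - exists (b - 1); split; [exact I | lra].
  - exists 0; split; exact I.
Qed.

(** The sign is read off at one point of the interval; a different sign elsewhere would force a zero
    by the intermediate value theorem. *)
Lemma continuous_constant_sign (a b : Rbar) (g : R -> R) :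
  Rbar_lt a b ->
  (forall t : R, in_itv a b t -> continuous g t /\ g t <> 0) ->
  exists e : R, is_sign e /\ forall t : R, in_itv a b t -> 0 < e * g t.
Proof.
  intros hab hg.
  destruct (in_itv_inhabited a b hab) as [t0 ht0].
  (* The factor [k] lets one increasing crossing serve both orders of the points: [k = e] to the
     left of [t0], [k = - e] to the right. *)
  assert (hivt : forall (k : R) (s t : R), in_itv a b s -> in_itv a b t -> s < t ->
    k * g s < 0 -> 0 < k * g t -> False).
  { intros k s t hs ht hst h1 h2.
    destruct (IVT_interv (fun x => k * g x) s t) as [z [hz hz0]]; try assumption.
    - intros x hx; apply continuity_pt_mult.
      + apply continuity_pt_const; intros ? ?; reflexivity.
      + apply continuity_pt_filterlim, hg, (in_itv_between a b s t); trivial.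
        rewrite Rmin_left, Rmax_right; lra.
    - destruct (hg z) as [_ hgz].
      + apply (in_itv_between a b s t); trivial; rewrite Rmin_left, Rmax_right; lra.
      + cbv beta in hz0; apply Rmult_integral in hz0.
        destruct hz0 as [-> | hz0]; [lra | exact (hgz hz0)]. }
  assert (hk : exists e, is_sign e /\ 0 < e * g t0).
  { destruct (hg t0 ht0) as [_ h0].
    destruct (Rdichotomy _ _ h0); [exists (-1) | exists 1]; split;
      unfold is_sign; lra. }
  destruct hk as [e [he h0]]; exists e; split; [exact he |].
  intros t ht; apply Rnot_le_lt; intros [hneg | hz].
  - destruct (Rtotal_order t t0) as [h | [-> | h]].
    + exact (hivt e t t0 ht ht0 h hneg h0).
    + lra.
    + apply (hivt (- e) t0 t ht0 ht h); lra.
  - apply Rmult_integral in hz; destruct hz as [-> | hz].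
    + lra.
    + exact (proj2 (hg t ht) hz).
Qed.

Lemma is_derive_0_constant (a b : Rbar) (g : R -> R) :
  (forall t : R, in_itv a b t -> is_derive g t 0) ->
  forall s t : R, in_itv a b s -> in_itv a b t -> g s = g t.
Proof.
  intros hg s t hs ht.
  destruct (MVT_gen g s t (fun _ => 0)) as [c [_ hc]].
  - intros x hx; apply hg, (in_itv_between a b s t); trivial; lra.
  - intros x hx; apply continuity_pt_filterlim.
    apply (ex_derive_continuous (K := R_AbsRing) (V := R_NormedModule)).
    exists 0; apply hg, (in_itv_between a b s t); trivial.
  - lra.
Qed.

(** * Smooth functions on an interval *)

Lemma smooth_on_is_derive (a b : Rbar) (g : R -> R) (t : R) :
  smooth_on a b g -> in_itv a b t -> is_derive g t (Derive g t).
Proof. intros hg ht; apply Derive_correct; exact (hg 1%nat t ht). Qed.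

Lemma smooth_on_continuous (a b : Rbar) (g : R -> R) (t : R) :
  smooth_on a b g -> in_itv a b t -> continuous g t.
Proof.
  intros hg ht; apply (ex_derive_continuous (K := R_AbsRing) (V := R_NormedModule)).
  exact (hg 1%nat t ht).
Qed.

Lemma smooth_on_continuous_Derive (a b : Rbar) (g : R -> R) (t : R) :
  smooth_on a b g -> in_itv a b t -> continuous (Derive g) t.
Proof.
  intros hg ht; apply (ex_derive_continuous (K := R_AbsRing) (V := R_NormedModule)).
  exact (hg 2%nat t ht).
Qed.

Lemma smooth_on_scal (a b : Rbar) (g : R -> R) (k : R) :
  smooth_on a b g -> smooth_on a b (fun t => k * g t).
Proof. intros hg n t ht; apply ex_derive_n_scal_l, hg, ht. Qed.

Lemma smooth_on_id (a b : Rbar) : smooth_on a b (fun t => t).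
Proof.
  intros n t _; apply ex_derive_n_ext with (fun t => t ^ 1).
  - intros s; apply pow_1.
  - apply ex_derive_n_pow.
Qed.

(** The sign of [g t] coming from the derivative of the absolute value cancels against the one in
    [Rabs (g t)]. *)
Lemma is_derive_ln_Rabs (g : R -> R) (t dg : R) :
  is_derive g t dg -> g t <> 0 ->
  is_derive (fun s => ln (Rabs (g s))) t (dg / g t).
Proof.
  intros hg h0.
  assert (hpos := Rabs_pos_lt _ h0).
  evar_last.
  - apply (is_derive_comp ln (fun s => Rabs (g s)) t (/ Rabs (g t))).
    + apply is_derive_ln, hpos.
    + apply is_derive_Rabs; [exact hg | exact h0].
  - unfold scal; simpl; unfold mult; simpl.
    destruct (Rdichotomy _ _ h0).
    + rewrite sign_eq_m1, Rabs_left by lra; field; exact h0.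
    + rewrite sign_eq_1, Rabs_right by lra; field; exact h0.
Qed.

(** * Velocities, time-like vectors and angles on the surface *)

Lemma velocity_R1 (f u v : R -> R) (c : R -> vec3) (t du dv : R) :
  ex_derive f (u t) -> is_derive u t du -> is_derive v t dv ->
  locally t (fun s => c s = Defs.R1 f (u s) (v s)) ->
  velocity c t =
    (du * cosh (v t) + u t * dv * sinh (v t),
     du * sinh (v t) + u t * dv * cosh (v t),
     du * Derive f (u t)).
Proof.
  intros hf hu hv hc.
  assert (hpr : forall (pr : vec3 -> R) (l : R),
    is_derive (fun s => pr (Defs.R1 f (u s) (v s))) t l ->
    Derive (fun s => pr (c s)) t = l).
  { intros pr l hl; apply is_derive_unique.
    (* A loxodrome is given by surface coordinates on its interval only, so [c] may be replaced near
       [t] but not globally. *)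
    apply is_derive_ext_loc with (2 := hl).
    generalize hc; apply filter_imp; intros s ->; reflexivity. }
  assert (hdu : Derive (fun s : R => u s) t = du) by exact (is_derive_unique _ _ _ hu).
  assert (hdv : Derive (fun s : R => v s) t = dv) by exact (is_derive_unique _ _ _ hv).
  unfold velocity; f_equal; [f_equal |]; apply hpr;
    unfold Defs.R1, px, py, pz; cbn [fst snd].
  - auto_derive.
    + repeat split; eexists; eassumption.
    + rewrite hdu, hdv; ring.
  - auto_derive.
    + repeat split; eexists; eassumption.
    + rewrite hdu, hdv; ring.
  - evar_last.
    + apply (is_derive_comp f u); [apply Derive_correct, hf | exact hu].
    + reflexivity.
Qed.

Lemma velocity_meridian (f : R -> R) (u v : R) :
  ex_derive f u -> velocity (meridian f v) u = (cosh v, sinh v, Derive f u).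
Proof.
  intros hf.
  (* The meridian has coordinates [u(s) = s] and constant [v]. *)
  rewrite (velocity_R1 f (fun s => s) (fun _ => v) _ u 1 0).
  - f_equal; [f_equal |]; ring.
  - exact hf.
  - exact (is_derive_id (K := R_AbsRing) u).
  - exact (is_derive_const (K := R_AbsRing) (V := R_NormedModule) v u).
  - apply filter_forall; reflexivity.
Qed.

(** The third components count only when both vectors are isotropic, so one non-isotropic argument
    settles the case. *)
Lemma scal_pi_non_isotropic (p q : vec3) :
  ~ isotropic p -> scal_pi p q = px p * px q - py p * py q.
Proof.
  intros hp; unfold scal_pi.
  destruct (isotropic_dec p); [contradiction | reflexivity].
Qed.

(** Isotropic vectors make the quadratic form vanish, so its negativity already excludes them. *)
Lemma timelike_iff (p : vec3) : timelike p <-> px p * px p - py p * py p < 0.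
Proof.
  unfold timelike; split.
  - intros [hp h]; rewrite scal_pi_non_isotropic in h; assumption.
  - intros h.
    assert (hp : ~ isotropic p).
    { intros [hx hy]; rewrite hx, hy in h; lra. }
    split; [exact hp |]; rewrite scal_pi_non_isotropic; assumption.
Qed.

Lemma timelike_norm (p : vec3) :
  timelike p -> norm_pi p = sqrt (py p * py p - px p * px p).
Proof.
  intros [hp h]; unfold norm_pi.
  rewrite Rabs_left, scal_pi_non_isotropic by assumption; f_equal; ring.
Qed.

Section CurveOnSurface.

Variables (f u v : R -> R) (c : R -> vec3) (t du dv : R).
Hypothesis (hf : ex_derive f (u t)) (hu : is_derive u t du) (hv : is_derive v t dv).
Hypothesis (hc : locally t (fun s => c s = Defs.R1 f (u s) (v s))).

(** This is minus the induced metric [du^2 - u^2 dv^2] evaluated on the velocity. *)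
Let speed2 := (u t * dv) * (u t * dv) - du * du.

(** The first two components of the velocity are the hyperbolic rotation by [v t] of
    [(du, u t * dv)], and such rotations preserve the form. *)
Lemma velocity_quadratic_form :
  py (velocity c t) * py (velocity c t) - px (velocity c t) * px (velocity c t)
  = speed2.
Proof using hf hu hv hc.
  rewrite (velocity_R1 f u v c t du dv hf hu hv hc); unfold px, py, speed2; cbn [fst snd].
  transitivity (((u t * dv) * (u t * dv) - du * du)
    * (cosh (v t) * cosh (v t) - sinh (v t) * sinh (v t))); [ring |].
  rewrite cosh_sqr; ring.
Qed.

Lemma timelike_velocity_iff : timelike (velocity c t) <-> 0 < speed2.
Proof using hf hu hv hc.
  rewrite timelike_iff, <- velocity_quadratic_form; lra.
Qed.

Lemma norm_velocity : 0 < speed2 -> norm_pi (velocity c t) = sqrt speed2.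
Proof using hf hu hv hc.
  intros h; rewrite timelike_norm by (apply timelike_velocity_iff; exact h).
  rewrite velocity_quadratic_form; reflexivity.
Qed.

(* The meridians are unit speed and orthogonal to the parallels, so the scalar
   product of [velocity c t] with the meridian direction is [du]. *)
Lemma angle_velocity_iff (eta : R) :
  0 < speed2 -> 0 <= eta ->
  is_angle_pi (velocity (meridian f (v t)) (u t)) (velocity c t) eta <->
  Rabs du = sqrt speed2 * sinh eta.
Proof using hf hu hv hc.
  intros hpos heta; unfold is_angle_pi.
  rewrite (velocity_meridian f (u t) (v t) hf).
  set (m := (cosh (v t), sinh (v t), Derive f (u t))).
  assert (hm : ~ isotropic m).
  { intros [h _]; pose proof (cosh_gt_0 (v t)); unfold m, px in h; simpl in h; lra. }
  assert (hmm : scal_pi m m = 1).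
  { rewrite scal_pi_non_isotropic by exact hm; unfold m, px, py; cbn [fst snd].
    rewrite cosh_sqr; ring. }
  assert (hmc : scal_pi m (velocity c t) = du).
  { rewrite scal_pi_non_isotropic by exact hm.
    rewrite (velocity_R1 f u v c t du dv hf hu hv hc); unfold m, px, py; cbn [fst snd].
    transitivity (du * (cosh (v t) * cosh (v t) - sinh (v t) * sinh (v t))); [ring |].
    rewrite cosh_sqr; ring. }
  assert (hnm : norm_pi m = 1).
  { unfold norm_pi; rewrite hmm, Rabs_R1; exact sqrt_1. }
  rewrite hmc, hnm, norm_velocity, Rmult_1_l by exact hpos.
  split.
  - intros (_ & _ & _ & _ & h); exact h.
  - intros h; repeat split; trivial.
    + right; split; [exact hm | lra].
    + apply timelike_velocity_iff, hpos.
    + apply timelike_velocity_iff, hpos.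
Qed.

End CurveOnSurface.

(** * Smoothness of the logarithm of the absolute value *)

Lemma is_derive_n_ln_Rabs (n : nat) (t : R) :
  t <> 0 ->
  is_derive_n (fun s => ln (Rabs s)) (S n) t ((-1) ^ n * INR (fact n) / t ^ S n).
Proof.
  revert t; induction n as [| n IH]; intros t ht.
  - simpl; evar_last.
    + apply (is_derive_ln_Rabs (fun s => s) t 1); [| exact ht].
      exact (is_derive_id (K := R_AbsRing) t).
    + field; exact ht.
  (* To differentiate once more, the closed form is needed on a neighbourhood of [t]; the nonzero
     reals are open. *)
  - apply (is_derive_ext_loc (fun s => (-1) ^ n * INR (fact n) / s ^ S n)).
    + apply locally_open with (fun s : R => s <> 0).
      * apply open_neq.
      * intros s hs; symmetry; apply is_derive_n_unique, IH, hs.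
      * exact ht.
    + assert (hp : forall k, t ^ k <> 0) by (intros k; apply pow_nonzero, ht).
      auto_derive.
      * apply (hp (S n)).
      * change (fact (S n)) with (S n * fact n)%nat.
        (* [INR (S n)] is folded back after unfolding, so that [field] treats it as a single
           atom. *)
        rewrite mult_INR; cbn [pred pow]; change (match n with 0%nat => 1 | S _ => INR n + 1 end) with (INR (S n)).
        field; auto.
Qed.

Lemma smooth_on_ln_Rabs (a b : Rbar) :
  (forall t : R, in_itv a b t -> t <> 0) ->
  smooth_on a b (fun t => ln (Rabs t)).
Proof.
  (* At order 0, [ex_derive_n] is [True]; the closed form covers all positive orders. *)
  intros h0 [| n] t ht; [exact I |].
  eexists; apply is_derive_n_ln_Rabs, h0, ht.
Qed.

(** * Loxodromes in the coordinates of the surface *)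

Lemma timelike_loxodrome_intro (f u v du dv : R -> R) (eta : R) (a b : Rbar) :
  smooth_on m_infty p_infty f -> 0 <= eta ->
  smooth_on a b u -> smooth_on a b v ->
  (forall t : R, in_itv a b t ->
     is_derive u t (du t) /\ is_derive v t (dv t) /\
     0 < (u t * dv t) * (u t * dv t) - du t * du t /\
     Rabs (du t) = sqrt ((u t * dv t) * (u t * dv t) - du t * du t) * sinh eta) ->
  timelike_loxodrome f eta a b (fun t => Defs.R1 f (u t) (v t)).
Proof.
  intros hf heta hu hv h; exists u, v; split; [exact hu | split; [exact hv |]].
  intros t ht; destruct (h t ht) as (hdu & hdv & hpos & hang).
  assert (hfu : ex_derive f (u t)) by exact (hf 1%nat (u t) (conj I I)).
  assert (hc : locally t (fun s => Defs.R1 f (u s) (v s) = Defs.R1 f (u s) (v s)))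
    by (apply filter_forall; reflexivity).
  split; [reflexivity | split].
  - exact (proj2 (timelike_velocity_iff f u v _ t _ _ hfu hdu hdv hc) hpos).
  - exact (proj2 (angle_velocity_iff f u v _ t _ _ hfu hdu hdv hc eta hpos heta) hang).
Qed.

(** The scalar conditions are phrased with the norm of the velocity, since this is the derivative
    required of an arc-length parameter. *)
Lemma timelike_loxodrome_elim (f : R -> R) (eta : R) (a b : Rbar) (c : R -> vec3) :
  smooth_on m_infty p_infty f -> 0 <= eta ->
  timelike_loxodrome f eta a b c ->
  exists u v : R -> R, smooth_on a b u /\ smooth_on a b v /\
    forall t : R, in_itv a b t ->
      c t = Defs.R1 f (u t) (v t) /\
      0 < norm_pi (velocity c t) /\
      norm_pi (velocity c t) * norm_pi (velocity c t)
        = (u t * Derive v t) * (u t * Derive v t) - Derive u t * Derive u t /\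
      Rabs (Derive u t) = norm_pi (velocity c t) * sinh eta.
Proof.
  intros hf heta (u & v & hu & hv & h); exists u, v.
  split; [exact hu | split; [exact hv |]]; intros t ht.
  destruct (h t ht) as (hct & htl & hang); split; [exact hct |].
  assert (hfu : ex_derive f (u t)) by exact (hf 1%nat (u t) (conj I I)).
  assert (hdu := smooth_on_is_derive a b u t hu ht).
  assert (hdv := smooth_on_is_derive a b v t hv ht).
  assert (hc : locally t (fun s => c s = Defs.R1 f (u s) (v s))).
  { generalize (in_itv_locally a b t ht); apply filter_imp.
    intros s hs; apply (h s hs). }
  assert (hpos := proj1 (timelike_velocity_iff f u v c t _ _ hfu hdu hdv hc) htl).
  rewrite (norm_velocity f u v c t _ _ hfu hdu hdv hc hpos).
  split; [apply sqrt_lt_R0, hpos | split].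
  - apply sqrt_sqrt, Rlt_le, hpos.
  - exact (proj1 (angle_velocity_iff f u v c t _ _ hfu hdu hdv hc eta hpos heta) hang).
Qed.

(** * Loxodromes at a positive angle *)

Lemma gamma2_timelike_loxodrome (f : R -> R) (eta e1 e2 : R) (a b : Rbar) :
  smooth_on m_infty p_infty f -> 0 < eta -> is_sign e1 -> is_sign e2 ->
  (forall t : R, in_itv a b t -> t <> 0) ->
  timelike_loxodrome f eta a b (gamma2 f e1 e2 eta).
Proof.
  intros hf heta he1 he2 h0.
  assert (hs := sinh_gt_0 eta heta).
  apply (timelike_loxodrome_intro f (fun t => e1 * t * sinh eta)
    (fun t => e2 * coth eta * ln (Rabs t))
    (fun _ => e1 * sinh eta) (fun t => e2 * coth eta * / t)).
  - exact hf.
  - lra.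
  - intros n t ht; apply ex_derive_n_scal_r, ex_derive_n_scal_l.
    exact (smooth_on_id a b n t ht).
  - apply smooth_on_scal, smooth_on_ln_Rabs, h0.
  - intros t ht; specialize (h0 t ht).
    (* The curve has unit speed: the signs square away, [t] cancels, and
       [cosh^2 eta - sinh^2 eta = 1] remains. *)
    assert (hspeed : e1 * t * sinh eta * (e2 * coth eta * / t)
        * (e1 * t * sinh eta * (e2 * coth eta * / t))
        - e1 * sinh eta * (e1 * sinh eta) = 1).
    { transitivity ((e1 * e1) * (e2 * e2) * (cosh eta * cosh eta)
        - (e1 * e1) * (sinh eta * sinh eta)).
      - unfold coth; field; split; lra.
      - rewrite !is_sign_sqr, cosh_sqr by assumption; ring. }
    rewrite hspeed, sqrt_1; split; [| split; [| split]].
    + auto_derive; [exact I | ring].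
    + apply is_derive_scal; evar_last.
      * apply (is_derive_ln_Rabs (fun s => s) t 1); [| exact h0].
        exact (is_derive_id (K := R_AbsRing) t).
      * field; exact h0.
    + lra.
    + rewrite Rabs_mult, (Rabs_right (sinh eta)) by lra; f_equal.
      apply is_sign_Rabs, he1.
Qed.

(** The rotation by [w] accounts for the integration constant of [v]. The origin of arc length is
    fixed by making [phi] proportional to [u]. *)
Lemma timelike_loxodrome_is_gamma2
    (f : R -> R) (eta : R) (a b : Rbar) (c : R -> vec3) :
  smooth_on m_infty p_infty f -> 0 < eta -> Rbar_lt a b ->
  timelike_loxodrome f eta a b c ->
  exists (e1 e2 w : R) (phi : R -> R),
    is_sign e1 /\ is_sign e2 /\ arc_length_parameter a b c phi /\
    forall s : R, in_itv a b s ->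
      phi s <> 0 /\ c s = hrot w (gamma2 f e1 e2 eta (phi s)).
Proof.
  intros hf heta hab hlox.
  assert (hs := sinh_gt_0 eta heta).
  destruct (timelike_loxodrome_elim f eta a b c hf (Rlt_le _ _ heta) hlox)
    as (u & v & hu & hv & h).
  assert (hdu0 : forall t, in_itv a b t -> Derive u t <> 0).
  { intros t ht hz; destruct (h t ht) as (_ & hn & _ & hang).
    rewrite hz, Rabs_R0 in hang; nra. }
  (* Otherwise the positive squared speed would equal [- u'^2]. *)
  assert (huv0 : forall t, in_itv a b t -> u t * Derive v t <> 0).
  { intros t ht hz; destruct (h t ht) as (_ & hn & hq & _); rewrite hz in hq; nra. }
  destruct (continuous_constant_sign a b (Derive u) hab) as (e1 & he1 & hpu).
  { intros t ht; split; [| exact (hdu0 t ht)].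
    exact (smooth_on_continuous_Derive a b u t hu ht). }
  destruct (continuous_constant_sign a b (fun t => u t * Derive v t) hab)
    as (e & he & hpv).
  { intros t ht; split; [| exact (huv0 t ht)].
    apply (continuous_mult (K := R_AbsRing)).
    - exact (smooth_on_continuous a b u t hu ht).
    - exact (smooth_on_continuous_Derive a b v t hv ht). }
  assert (h11 := is_sign_sqr e1 he1); assert (hee := is_sign_sqr e he).
  (* With [e1] the sign of [u'], the angle condition reads [e1 u' = L sinh eta], where [L] is the
     speed. *)
  assert (hnorm : forall t, in_itv a b t ->
    norm_pi (velocity c t) = e1 / sinh eta * Derive u t).
  { intros t ht; destruct (h t ht) as (_ & _ & _ & hang).
    assert (habs : Rabs (Derive u t) = e1 * Derive u t).
    { rewrite <- (Rabs_pos_eq (e1 * _)) by (apply Rlt_le, hpu, ht).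
      rewrite Rabs_mult, (is_sign_Rabs e1 he1); ring. }
    apply Rmult_eq_reg_r with (sinh eta); [| lra].
    rewrite <- hang, habs; field; lra. }
  set (phi := fun t => e1 / sinh eta * u t).
  assert (hu0 : forall t, in_itv a b t -> u t <> 0).
  { intros t ht hz; apply (huv0 t ht); rewrite hz; ring. }
  assert (hphi0 : forall t, in_itv a b t -> phi t <> 0).
  { intros t ht; unfold phi; apply Rmult_integral_contrapositive; split; [| auto].
    apply Rmult_integral_contrapositive; split; [intros ->; lra |].
    apply Rinv_neq_0_compat; lra. }
  assert (hdphi : forall t, in_itv a b t ->
    is_derive phi t (e1 / sinh eta * Derive u t)).
  { intros t ht; apply is_derive_scal; exact (smooth_on_is_derive a b u t hu ht). }
  assert (hdv : forall t, in_itv a b t ->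
    Derive v t = e * e1 * coth eta * (Derive u t / u t)).
  { intros t ht; destruct (h t ht) as (_ & _ & hq & _).
    rewrite (hnorm t ht) in hq.
    (* Both sides are positive by the choice of signs, so it suffices to compare squares, using
       [L = e1 u' / sinh eta] and [coth^2 eta = 1 + 1 / sinh^2 eta]. *)
    assert (heq : e * (u t * Derive v t) = e1 * (coth eta * Derive u t)).
    { apply Rsqr_inj.
      - apply Rlt_le, hpv, ht.
      - specialize (hpu t ht); pose proof (cosh_gt_0 eta).
        replace (e1 * (coth eta * Derive u t)) with (coth eta * (e1 * Derive u t)) by ring.
        apply Rlt_le, Rmult_lt_0_compat; [| exact hpu].
        apply Rdiv_lt_0_compat; assumption.
      - unfold Rsqr.
        transitivity ((e * e) * (u t * Derive v t * (u t * Derive v t))); [ring |].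
        transitivity ((e1 * e1) * (coth eta * coth eta * (Derive u t * Derive u t)));
          [| ring].
        replace (coth eta * coth eta) with (1 + 1 / (sinh eta * sinh eta)).
        + rewrite hee, h11.
          replace (u t * Derive v t * (u t * Derive v t))
            with (e1 / sinh eta * Derive u t * (e1 / sinh eta * Derive u t)
                  + Derive u t * Derive u t) by lra.
          transitivity (((e1 * e1) / (sinh eta * sinh eta) + 1)
            * (Derive u t * Derive u t)); [field; lra |].
          rewrite h11; ring.
        + unfold coth; transitivity (cosh eta * cosh eta / (sinh eta * sinh eta));
            [rewrite cosh_sqr |]; field; lra. }
    apply Rmult_eq_reg_l with (e * u t).
    - transitivity (e * (u t * Derive v t)); [ring |].
      rewrite heq; transitivity ((e * e) * (e1 * (coth eta * Derive u t))).
      + rewrite hee; ring.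
      + field; auto.
    - specialize (hpv t ht); intros hz.
      replace (e * (u t * Derive v t)) with (e * u t * Derive v t) in hpv by ring.
      rewrite hz in hpv; lra. }
  destruct (in_itv_inhabited a b hab) as [t0 ht0].
  (* [e2] is the sign of the quotient of [u v'] by [u'], which equals [e2 coth eta]. *)
  set (e2 := e * e1) in hdv.
  (* [phi' / phi = u' / u], so [g] has derivative zero; its constant value is the rotation
     parameter. *)
  set (g := fun t => v t - e2 * coth eta * ln (Rabs (phi t))).
  exists e1, e2, (g t0), phi.
  split; [exact he1 | split; [| split; [split |]]].
  - unfold e2; destruct he as [-> | ->], he1 as [-> | ->]; unfold is_sign; lra.
  - apply smooth_on_scal, hu.
  - intros s hs'; rewrite (hnorm s hs'); exact (hdphi s hs').
  - intros s hs'; split; [exact (hphi0 s hs') |].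
    change (gamma2 f e1 e2 eta (phi s)) with
      (Defs.R1 f (e1 * phi s * sinh eta) (e2 * coth eta * ln (Rabs (phi s)))).
    rewrite hrot_R1, (proj1 (h s hs')); f_equal.
    + unfold phi; transitivity ((e1 * e1) * u s); [rewrite h11; ring | field; lra].
    + assert (hg : g t0 = g s).
      { apply (is_derive_0_constant a b); trivial; intros t ht.
        evar_last.
        - apply (is_derive_minus (K := R_AbsRing) (V := R_NormedModule)).
          + exact (smooth_on_is_derive a b v t hv ht).
          + apply is_derive_scal, (is_derive_ln_Rabs phi); [exact (hdphi t ht) |].
            exact (hphi0 t ht).
        - unfold minus, plus, opp; simpl; rewrite (hdv t ht); unfold phi.
          field; repeat split; try lra; [exact (hu0 t ht) | intros hz; subst e1; lra]. }
      rewrite hg; unfold g; ring.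
Qed.

(** * Loxodromes at angle zero: the parallels *)

Lemma parallel_timelike_loxodrome (f : R -> R) (e r : R) (a b : Rbar) :
  smooth_on m_infty p_infty f -> is_sign e -> r <> 0 ->
  timelike_loxodrome f 0 a b (parallel_curve f e r).
Proof.
  intros hf he hr.
  apply (timelike_loxodrome_intro f (fun _ => r) (fun t => e * t / r)
    (fun _ => 0) (fun _ => e / r)).
  - exact hf.
  - lra.
  - intros n t _; apply ex_derive_n_const.
  - intros n t ht; apply ex_derive_n_scal_r, ex_derive_n_scal_l.
    exact (smooth_on_id a b n t ht).
  - intros t _; split; [| split; [| split]].
    + exact (is_derive_const (K := R_AbsRing) (V := R_NormedModule) r t).
    + auto_derive; [exact I | field; exact hr].
    + replace (r * (e / r) * (r * (e / r)) - 0 * 0) with (e * e) by (field; exact hr).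
      rewrite is_sign_sqr by exact he; lra.
    + rewrite sinh_0, Rabs_R0; ring.
Qed.

(** No rotation appears: rotating a parallel only shifts its arc length, and [phi] takes up the
    shift. *)
Lemma timelike_loxodrome_is_parallel
    (f : R -> R) (a b : Rbar) (c : R -> vec3) :
  smooth_on m_infty p_infty f -> Rbar_lt a b ->
  timelike_loxodrome f 0 a b c ->
  exists (e r : R) (phi : R -> R),
    is_sign e /\ r <> 0 /\ arc_length_parameter a b c phi /\
    forall s : R, in_itv a b s -> c s = parallel_curve f e r (phi s).
Proof.
  intros hf hab hlox.
  destruct (timelike_loxodrome_elim f 0 a b c hf (Rle_refl 0) hlox)
    as (u & v & hu & hv & h).
  assert (hdu : forall t, in_itv a b t -> Derive u t = 0).
  { intros t ht; destruct (h t ht) as (_ & _ & _ & hang).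
    rewrite sinh_0, Rmult_0_r in hang; apply Rabs_eq_0; exact hang. }
  destruct (in_itv_inhabited a b hab) as [t0 ht0].
  set (r := u t0).
  assert (hr : forall t, in_itv a b t -> u t = r).
  { intros t ht; apply (is_derive_0_constant a b); trivial; intros x hx.
    rewrite <- (hdu x hx); exact (smooth_on_is_derive a b u x hu hx). }
  assert (hq : forall t, in_itv a b t ->
    norm_pi (velocity c t) * norm_pi (velocity c t)
    = (r * Derive v t) * (r * Derive v t)).
  { intros t ht; destruct (h t ht) as (_ & _ & hq & _).
    rewrite (hr t ht), (hdu t ht) in hq; lra. }
  (* With [u' = 0], the positive squared speed is [(r v')^2]. *)
  assert (hrv : forall t, in_itv a b t -> r * Derive v t <> 0).
  { intros t ht hz; destruct (h t ht) as (_ & hn & _).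
    specialize (hq t ht); rewrite hz in hq; nra. }
  destruct (continuous_constant_sign a b (fun t => r * Derive v t) hab)
    as (e & he & hpos).
  { intros t ht; split; [| exact (hrv t ht)].
    apply (continuous_mult (K := R_AbsRing)); [apply continuous_const |].
    exact (smooth_on_continuous_Derive a b v t hv ht). }
  assert (hee := is_sign_sqr e he).
  assert (hr0 : r <> 0) by (intros hz; apply (hrv t0 ht0); rewrite hz; ring).
  (* With [e] the sign of [r v'], the speed is [e r v'], which this parameter integrates; then
     [e phi / r = e^2 v = v]. *)
  exists e, r, (fun t => e * r * v t).
  split; [exact he | split; [exact hr0 | split; [split |]]].
  - apply smooth_on_scal, hv.
  - intros s hs.
    replace (norm_pi (velocity c s)) with (e * r * Derive v s).
    + apply is_derive_scal; exact (smooth_on_is_derive a b v s hv hs).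
    + destruct (h s hs) as (_ & hn & _); rewrite Rmult_assoc.
      apply Rsqr_inj; [apply Rlt_le, hpos, hs | lra |].
      unfold Rsqr; rewrite (hq s hs).
      transitivity ((e * e) * (r * Derive v s * (r * Derive v s))); [ring |].
      rewrite hee; ring.
  - intros s hs; rewrite (proj1 (h s hs)), (hr s hs); unfold parallel_curve; f_equal.
    transitivity ((e * e) * v s); [rewrite hee; ring | field; exact hr0].
Qed.

Theorem theorem3p2 :
  forall (f : R -> R) (eta : R),
    smooth_on m_infty p_infty f ->
    0 <= eta ->
    (0 < eta ->
       (forall e1 e2 : R, is_sign e1 -> is_sign e2 ->
          timelike_loxodrome f eta m_infty 0 (gamma2 f e1 e2 eta) /\
          timelike_loxodrome f eta 0 p_infty (gamma2 f e1 e2 eta)) /\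
       (forall (a b : Rbar) (c : R -> vec3),
          Rbar_lt a b ->
          timelike_loxodrome f eta a b c ->
          exists (e1 e2 w : R) (phi : R -> R),
            is_sign e1 /\ is_sign e2 /\
            arc_length_parameter a b c phi /\
            forall s : R, in_itv a b s ->
              phi s <> 0 /\ c s = hrot w (gamma2 f e1 e2 eta (phi s)))) /\
    (eta = 0 ->
       (forall e r : R, is_sign e -> r <> 0 ->
          timelike_loxodrome f eta m_infty p_infty (parallel_curve f e r)) /\
       (forall (a b : Rbar) (c : R -> vec3),
          Rbar_lt a b ->
          timelike_loxodrome f eta a b c ->
          exists (e r : R) (phi : R -> R),
            is_sign e /\ r <> 0 /\
            arc_length_parameter a b c phi /\
            forall s : R, in_itv a b s ->
              c s = parallel_curve f e r (phi s))).
Proof.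
  intros f eta hf _; split.
  - intros heta; split.
    (* Each of the two half-lines avoids 0, where the logarithm is singular. *)
    + intros e1 e2 he1 he2; split; apply gamma2_timelike_loxodrome; trivial;
        intros t [h1 h2]; simpl in h1, h2; lra.
    + intros a b c; exact (timelike_loxodrome_is_gamma2 f eta a b c hf heta).
  - intros ->; split.
    + intros e r; exact (parallel_timelike_loxodrome f e r _ _ hf).
    + intros a b c; exact (timelike_loxodrome_is_parallel f a b c hf).
Qed.
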